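(* Let $u_0\in D((-A)^s)$ and let $$v(t)=\sum_{k=0}^N \gamma_k(t)\,S^k(h)\,S(h/2)\,(-A)^su_0 .$$ Then $$\|v(t)\|\le C\|(-A)^su_0\|,\quad t\in[0,\infty),$$ where $C$ is a constant independent of $h$ and $k=0,\ldots,N$.
   Context: Let $X$ be a real separable Banach space with norm $\|\cdot\|$ (also used for the operator norm), and let $s\in(0,1)$. Let $A:D(A)\subseteq X\to X$ be a closed, densely defined linear operator that is strictly $m$-dissipative, i.e. $\|(I-tA)u\|>\|u\|$ for all $0\ne u\in D(A)$ and $t>0$, and $R(I-tA)=X$ (range) for all $t\ge 0$. Fractional powers: the Balakrishnan operator is $J_{-A}^su=\frac{1}{\Gamma(s)\Gamma(1-s)}\int_0^\infty z^{s-1}(z-A)^{-1}(-A)u\,dz$ for $u\in D(A)$, and $(-A)^s$ is its closure $\overline{J_{-A}^s}$. Discretization: fix $M,N\in\mathbb N$ with $0\ll M<N<\infty$; set $h=M/(N+1)$, $z_k=kh$ for $k=0,\ldots,N+1$, and $z_{k+1/2}=z_k+h/2$. Define $$\gamma_k(t)=\frac{h^s[(k+1)^s-k^s]}{\Gamma(1+s)}e^{-t^2/(4z_{k+1/2})},\qquad S(w)=\left(I-\frac w2A\right)^{-1}\left(I+\frac w2A\right).$$ It is assumed that $S(w)$ is nonexpansive in $X$, i.e. $\|S(w)x\|\le\|x\|$ for $w\geq 0$. *)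

(* Defs.v *)
From Stdlib Require Export Reals.
From Coquelicot Require Export Coquelicot.

Open Scope R_scope.

Set Implicit Arguments.
Unset Strict Implicit.
Unset Printing Implicit Defensive.

Definition adherent {T : UniformSpace} (P : T -> Prop) (x : T) : Prop :=
  forall eps : posreal, exists y : T, ball x eps y /\ P y.

Definition dense {T : UniformSpace} (P : T -> Prop) : Prop :=
  forall x : T, adherent P x.

Definition separable (T : UniformSpace) : Prop :=
  exists d : nat -> T, dense (fun x => exists n, x = d n).

(* Possibly unbounded operators on X.  The values of [ev] outside [dom] are
   meaningless. *)
Record operator (X : Type) := Operator { dom : X -> Prop; ev : X -> X }.

Section Operators.

Variable X : CompleteNormedModule R_AbsRing.
Implicit Types (A B : operator X) (u x y : X) (s t w z : R).

Definition graph A (p : X * X) : Prop := dom A (fst p) /\ snd p = ev A (fst p).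

Definition linear_operator A : Prop :=
  dom A zero /\
  (forall u x, dom A u -> dom A x ->
     dom A (plus u x) /\ ev A (plus u x) = plus (ev A u) (ev A x)) /\
  (forall (a : R) u, dom A u ->
     dom A (scal a u) /\ ev A (scal a u) = scal a (ev A u)).

Definition closed_operator A : Prop := closed (graph A).

Definition densely_defined A : Prop := dense (dom A).

Definition id_op : operator X := Operator (fun _ => True) (fun u => u).

(* [0 * A] is the zero operator on all of X, so that [I - 0 * A] is [I] and not
   its restriction to [dom A]. *)
Definition scal_op (a : R) A : operator X :=
  Operator (fun u => a <> 0 -> dom A u) (fun u => scal a (ev A u)).

Definition add_op A B : operator X :=
  Operator (fun u => dom A u /\ dom B u) (fun u => plus (ev A u) (ev B u)).

Definition sub_op A B : operator X :=
  Operator (fun u => dom A u /\ dom B u) (fun u => minus (ev A u) (ev B u)).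

Definition comp_op A B : operator X :=
  Operator (fun u => dom B u /\ dom A (ev B u)) (fun u => ev A (ev B u)).

Definition range A y : Prop := exists u, dom A u /\ ev A u = y.

(* [iota] is definite description: the value is the preimage when [A] is
   injective. *)
Definition inv_op A : operator X :=
  Operator (range A) (fun y => iota (fun u => dom A u /\ ev A u = y)).

(* The operator whose graph is the closure of the graph of [A], when [A] is
   closable. *)
Definition closure_op A : operator X :=
  Operator (fun u => exists y, adherent (graph A) (u, y))
           (fun u => iota (fun y => adherent (graph A) (u, y))).

Definition strictly_m_dissipative A : Prop :=
  (forall u t, dom A u -> u <> zero -> 0 < t ->
     norm u < norm (ev (sub_op id_op (scal_op t A)) u)) /\
  (forall t, 0 <= t -> forall y, range (sub_op id_op (scal_op t A)) y).

Definition Gamma (x : R) : R :=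
  RInt_gen (fun t : R => Rpower t (x - 1) * exp (- t))
           (at_right 0) (Rbar_locally p_infty).

(* The operator [z - A]. *)
Definition shift z A : operator X := sub_op (scal_op z id_op) A.

Definition balakrishnan A s : operator X :=
  Operator (dom A) (fun u =>
    scal (/ (Gamma s * Gamma (1 - s)))
      (RInt_gen (fun z : R => scal (Rpower z (s - 1))
                   (ev (inv_op (shift z A)) (ev (scal_op (-1) A) u)))
                (at_right 0) (Rbar_locally p_infty))).

(* The fractional power (-A)^s. *)
Definition frac_pow A s : operator X := closure_op (balakrishnan A s).

(* S(w) = (I - w/2 A)^-1 (I + w/2 A).  For w > 0 the composite itself is only
   defined on the dense subspace [dom A]; the closure extends it to all of X. *)
Definition cayley A w : operator X :=
  closure_op (comp_op (inv_op (sub_op id_op (scal_op (w / 2) A)))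
                      (add_op id_op (scal_op (w / 2) A))).

Definition step (M N : nat) : R := INR M / INR (N + 1).

(* Stdlib has [Rpower 0 s = 1], whereas 0^s = 0 is needed in the weight for
   k = 0. *)
Definition rpow (x s : R) : R := if Rlt_dec 0 x then Rpower x s else 0.

Definition gamma_weight s (M N k : nat) t : R :=
  let h := step M N in
  rpow h s * (rpow (INR (k + 1)) s - rpow (INR k) s) / Gamma (1 + s)
  * exp (- (t ^ 2 / (4 * (INR k * h + h / 2)))).

Definition discrete_solution A s (M N : nat) (u0 : X) t : X :=
  let h := step M N in
  sum_n (fun k => scal (gamma_weight s M N k t)
                    (Nat.iter k (ev (cayley A h))
                       (ev (cayley A (h / 2)) (ev (frac_pow A s) u0)))) N.

End Operators.

(* Main.v *)
Require Import Defs.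
From Stdlib Require Import Lra Lia.

(** The weights are summable uniformly in the mesh.  The Gaussian factor is at
    most 1, so the [k]-th weight is dominated by
    [h^s ((k+1)^s - k^s) / Gamma (1 + s)], a difference of consecutive terms of
    a nondecreasing sequence.  These differences telescope
    ([norm_sum_n_scal_telescope]), and their sum from [0] to [N] is
    [h^s (N+1)^s / Gamma (1 + s) = M^s / Gamma (1 + s)], because
    [h (N+1) = M]: refining the mesh does not change the length [M] of the
    interval.  Since all the vectors in the sum are images of
    [(-A)^s u0] under nonexpansive maps, the triangle inequality gives the
    bound with [C = M^s / |Gamma (1 + s)|]. *)

Lemma norm_iter_nonexpansive (X : NormedModule R_AbsRing) (f : X -> X) :
  (forall x, norm (f x) <= norm x) ->
  forall k x, norm (Nat.iter k f x) <= norm x.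
Proof.
intros Hf k x; induction k as [|k IH]; simpl.
- apply Rle_refl.
- apply Rle_trans with (2 := IH), Hf.
Qed.

Lemma norm_sum_n_scal_telescope (X : NormedModule R_AbsRing)
    (a c : nat -> R) (v : nat -> X) (r : R) (n : nat) :
  (forall k, Rabs (c k) <= a (S k) - a k) ->
  (forall k, norm (v k) <= r) ->
  norm (sum_n (fun k => scal (c k) (v k)) n) <= (a (S n) - a 0%nat) * r.
Proof.
intros Hc Hv.
assert (Hterm : forall k, norm (scal (c k) (v k)) <= (a (S k) - a k) * r).
{ intros k; apply Rle_trans with (1 := norm_scal (c k) (v k)).
  apply Rmult_le_compat; [apply Rabs_pos | apply norm_ge_0 | apply Hc | apply Hv]. }
induction n as [|n IH].
- rewrite sum_O; apply Hterm.
- rewrite sum_Sn; eapply Rle_trans; [apply (norm_triangle (V := X)) |].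
  specialize (Hterm (S n)); lra.
Qed.

Lemma rpow_nonneg x s : 0 <= rpow x s.
Proof.
unfold rpow; destruct (Rlt_dec 0 x); [apply Rlt_le, exp_pos | lra].
Qed.

Lemma rpow_le x y s : 0 <= s -> x <= y -> rpow x s <= rpow y s.
Proof.
intros Hs Hxy; unfold rpow at 1; destruct (Rlt_dec 0 x) as [Hx|Hx].
- unfold rpow; destruct (Rlt_dec 0 y); [apply Rle_Rpower_l; lra | lra].
- apply rpow_nonneg.
Qed.

Lemma rpow_mult x y s : 0 < x -> 0 < y -> rpow x s * rpow y s = rpow (x * y) s.
Proof.
intros Hx Hy; pose proof (Rmult_lt_0_compat _ _ Hx Hy).
unfold rpow.
destruct (Rlt_dec 0 x), (Rlt_dec 0 y), (Rlt_dec 0 (x * y)); try lra.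
now apply Rpower_mult_distr.
Qed.

Lemma step_pos M N : (0 < M)%nat -> 0 < step M N.
Proof.
intros HM; apply Rdiv_lt_0_compat; apply lt_0_INR; lia.
Qed.

Lemma exp_opp_le_1 x : 0 <= x -> exp (- x) <= 1.
Proof.
intros [Hx | <-].
- rewrite <- exp_0; apply Rlt_le, exp_increasing; lra.
- rewrite Ropp_0, exp_0; lra.
Qed.

(** The majorant is the increment at [k] of the sequence
    [k |-> |1 / Gamma (1 + s)| h^s k^s], the form that telescopes.  The absolute
    value makes the estimate independent of the sign of [Gamma]. *)
Lemma Rabs_gamma_weight_le s M N k t : 0 <= s -> (0 < M)%nat ->
  Rabs (gamma_weight s M N k t) <=
    Rabs (/ Gamma (1 + s)) * rpow (step M N) s * rpow (INR (S k)) s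
    - Rabs (/ Gamma (1 + s)) * rpow (step M N) s * rpow (INR k) s.
Proof.
intros Hs HM; pose proof (step_pos M N HM) as Hh.
unfold gamma_weight; cbv zeta; unfold Rdiv at 1.
replace (k + 1)%nat with (S k) by lia.
assert (Hincr : rpow (INR k) s <= rpow (INR (S k)) s)
  by (apply rpow_le; [assumption | apply le_INR; lia]).
assert (Hexp : exp (- (t ^ 2 / (4 * (INR k * step M N + step M N / 2)))) <= 1).
{ apply exp_opp_le_1, Rdiv_le_0_compat; [apply pow2_ge_0 |].
  pose proof (Rmult_le_pos _ _ (pos_INR k) (Rlt_le _ _ Hh)); lra. }
rewrite !Rabs_mult, (Rabs_pos_eq _ (rpow_nonneg _ _)),
  (Rabs_pos_eq (_ - _)), (Rabs_pos_eq (exp _)) by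
  (try apply Rlt_le, exp_pos; lra).
rewrite <- Rmult_minus_distr_l.
set (B := rpow (step M N) s * _ * _).
replace (_ * _ * (_ - _)) with (B * 1) by (unfold B; ring).
apply Rmult_le_compat_l; [| exact Hexp].
apply Rmult_le_pos; [apply Rmult_le_pos; [apply rpow_nonneg | lra] | apply Rabs_pos].
Qed.

Theorem lemma3p2 :
  forall (X : CompleteNormedModule R_AbsRing) (A : operator X) (s : R) (M : nat),
    separable X ->
    0 < s < 1 ->
    linear_operator A ->
    closed_operator A ->
    densely_defined A ->
    strictly_m_dissipative A ->
    (forall (w : R) (x : X), 0 <= w -> norm (ev (cayley A w) x) <= norm x) ->
    (0 < M)%nat ->
    exists C : R,
      forall (N : nat) (u0 : X) (t : R),
        (M < N)%nat ->
        dom (frac_pow A s) u0 ->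
        0 <= t ->
        norm (discrete_solution A s M N u0 t) <= C * norm (ev (frac_pow A s) u0).
Proof.
intros X A s M _ Hs _ _ _ _ Hcayley HM.
exists (Rabs (/ Gamma (1 + s)) * rpow (INR M) s).
intros N u0 t _ _ _.
pose proof (step_pos M N HM) as Hh.
set (a := fun k => Rabs (/ Gamma (1 + s)) * rpow (step M N) s * rpow (INR k) s).
assert (Hsum : a (S N) - a 0%nat = Rabs (/ Gamma (1 + s)) * rpow (INR M) s).
{ unfold a.
  (* The boundary term at [k = 0] vanishes because [rpow 0 s = 0]. *)
  replace (rpow (INR 0) s) with 0
    by (unfold rpow; simpl; destruct (Rlt_dec 0 0); lra).
  rewrite Rmult_0_r, Rminus_0_r, Rmult_assoc, rpow_mult
    by (try apply lt_0_INR; lia || assumption).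
  do 2 f_equal; unfold step.
  replace (N + 1)%nat with (S N) by lia.
  field; apply not_0_INR; lia. }
rewrite <- Hsum.
unfold discrete_solution; cbv zeta.
apply norm_sum_n_scal_telescope.
- intros k; apply Rabs_gamma_weight_le; [lra | assumption].
- intros k; eapply Rle_trans.
  + apply norm_iter_nonexpansive; intros x; apply Hcayley; lra.
  + apply Hcayley; lra.
Qed.
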